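(* Let $(X,d,A)$ be a metric pair, and let $\rho$ denote the Grothendieck metric on the group $K(X,A)$ of virtual persistence diagrams. With respect to the metric topology induced by $\rho$, the topological group $(K(X,A),\rho)$ is locally compact if and only if it is discrete.
   Context: A metric pair $(X,d,A)$ is a metric space $(X,d)$ with a distinguished subset $A\subseteq X$. Put $d(x,A):=\inf_{a\in A}d(x,a)$ and define the $1$-strengthened metric $d_1(x,y):=\min\bigl(d(x,y),\,d(x,A)+d(y,A)\bigr)$ for $x,y\in X$. Let $X/A$ be the quotient collapsing $A$ to one point $[A]$; $d_1$ descends to $X/A$ (with $d_1(x,[A])=d(x,A)$). Standing assumption: $A$ is nonempty and the descended $d_1$ is a genuine (separated) metric on $X/A$, i.e. $d(x,A)>0$ for every $x\in X\setminus A$. For a set $Y$, $D(Y)$ is the free commutative monoid on $Y$ (finite multisets). $D(X,A):=D(X)/D(A)$ is the commutative monoid of finite persistence diagrams; it is the free commutative monoid on $X\setminus A$. For $\alpha,\beta\in D(X,A)$, a matching between $\alpha$ and $\beta$ is an element $\sigma\in D(X\times X)$ whose first and second marginals agree with $\alpha$ and $\beta$ respectively modulo $D(A)$, and $W_1(\alpha,\beta):=\inf_\sigma\sum_{(x,y)\in\sigma}d_1(x,y)$, the infimum being over all such matchings (sum with multiplicity). $K(X,A)$ is the Grothendieck group of $D(X,A)$; its elements are formal differences $\alpha-\beta$ with $\alpha,\beta\in D(X,A)$. The Grothendieck metric is $\rho(\alpha-\beta,\gamma-\delta):=W_1(\alpha+\delta,\gamma+\beta)$, which is a well-defined translation-invariant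 metric on $K(X,A)$ extending $W_1$. *)

(* Defs.v *)
From HB Require Import structures.
From mathcomp Require Import all_boot all_order all_algebra.
From mathcomp Require Import generic_quotient finmap multiset.
From mathcomp Require Import all_classical all_reals all_analysis.
From mathcomp Require Import lra.

Set Implicit Arguments.
Unset Strict Implicit.
Unset Printing Implicit Defensive.

Import Order.TTheory GRing.Theory Num.Theory.

Local Open Scope classical_set_scope.
Local Open Scope mset_scope.
Local Open Scope ring_scope.
Local Open Scope quotient_scope.

Section Grothendieck.
Variable M : nmodType.
Implicit Types p q : M * M.

Definition groth_rel : rel (M * M) :=
  fun p q => `[< exists k : M, p.1 + q.2 + k = q.1 + p.2 + k >].

Lemma groth_rel_refl : reflexive groth_rel.
Proof. by move=> p; apply/asboolP; exists 0. Qed.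

Lemma groth_rel_sym : symmetric groth_rel.
Proof. by move=> p q; apply/asboolP/asboolP => -[k pq]; exists k; rewrite pq. Qed.

Lemma groth_rel_trans : transitive groth_rel.
Proof.
move=> q p r /asboolP[k pq] /asboolP[l qr]; apply/asboolP.
exists (q.2 + k + (q.1 + l)).
rewrite !addrA [LHS](ACl ((1*3*4)*(5*2*6)))/= pq qr.
by rewrite !addrA [LHS](ACl (4*2*5*3*1*6))/=.
Qed.

Canonical groth_equiv :=
  EquivRel groth_rel groth_rel_refl groth_rel_sym groth_rel_trans.

Definition groth : Type := {eq_quot groth_rel}.
HB.instance Definition _ := EqQuotient.on groth.
HB.instance Definition _ := Choice.on groth.

(* The formal difference a - b of two elements of the monoid. *)
Definition gdiff (a b : M) : groth := \pi_groth (a, b).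

Lemma gdiffP a b c d :
  gdiff a b = gdiff c d <-> exists k, a + d + k = c + b + k.
Proof. by split => [/eqmodP/asboolP//|h]; apply/eqmodP/asboolP. Qed.

Lemma groth_ind (Q : groth -> Prop) :
  (forall a b, Q (gdiff a b)) -> forall x, Q x.
Proof. by move=> h; elim/quotW => -[a b]; exact: h. Qed.

Lemma gdiff_repr (x : groth) : gdiff (repr x).1 (repr x).2 = x.
Proof. by rewrite /gdiff -surjective_pairing reprK. Qed.

Definition groth_add (x y : groth) : groth :=
  gdiff ((repr x).1 + (repr y).1) ((repr x).2 + (repr y).2).

Definition groth_opp (x : groth) : groth := gdiff (repr x).2 (repr x).1.

Lemma groth_addE a b c d :
  groth_add (gdiff a b) (gdiff c d) = gdiff (a + c) (b + d).
Proof.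
rewrite /groth_add; have := gdiff_repr (gdiff a b).
case: (repr _) => a' b' /= /gdiffP[k abk].
have := gdiff_repr (gdiff c d); case: (repr _) => c' d' /= /gdiffP[l cdl].
apply/gdiffP; exists (k + l).
rewrite !addrA [LHS](ACl ((1*3*5)*(2*4*6)))/= abk cdl.
by rewrite !addrA [RHS](ACl ((1*3*5)*(2*4*6)))/= !addrA.
Qed.

Lemma groth_oppE a b : groth_opp (gdiff a b) = gdiff b a.
Proof.
rewrite /groth_opp; have := gdiff_repr (gdiff a b).
case: (repr _) => a' b' /= /gdiffP[k abk].
by apply/gdiffP; exists k; rewrite (addrC b') (addrC b).
Qed.

Lemma groth_addA : associative groth_add.
Proof.
elim/groth_ind => a b; elim/groth_ind => c d; elim/groth_ind => e f.
by rewrite !groth_addE !addrA.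
Qed.

Lemma groth_addC : commutative groth_add.
Proof.
elim/groth_ind => a b; elim/groth_ind => c d.
by rewrite !groth_addE (addrC a) (addrC b).
Qed.

Lemma groth_add0 : left_id (gdiff 0 0) groth_add.
Proof. by elim/groth_ind => a b; rewrite groth_addE !add0r. Qed.

Lemma groth_addN : left_inverse (gdiff 0 0) groth_opp groth_add.
Proof.
elim/groth_ind => a b; rewrite groth_oppE groth_addE; apply/gdiffP.
by exists 0; rewrite (addrC a) addr0 add0r.
Qed.

HB.instance Definition _ :=
  GRing.isZmodule.Build groth groth_addA groth_addC groth_add0 groth_addN.

Lemma gdiffD a b c d : gdiff a b + gdiff c d = gdiff (a + c) (b + d).
Proof. exact: groth_addE. Qed.

Lemma gdiffN a b : - gdiff a b = gdiff b a.
Proof. exact: groth_oppE. Qed.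

End Grothendieck.

(* d(x, A); [inf] is the real infimum, meaningful only when [A] is nonempty. *)
Definition setdist {R : realType} {X : metricType R} (A : set X) (x : X) : R :=
  inf [set mdist x a | a in A].

(* Nonemptiness and separation say exactly that the 1-strengthened metric [d1]
   below descends to a genuine metric on X/A. *)
Record metricPair (R : realType) := MetricPair {
  mp_space :> metricType R;
  mp_sub : set mp_space;
  mp_sub_nonempty : mp_sub !=set0;
  mp_sub_separated : forall x, ~ mp_sub x -> 0 < setdist mp_sub x
}.

Section MetricPairDiagrams.
Context {R : realType} (P : metricPair R).
Local Notation X := (mp_space P).
Local Notation A := (@mp_sub R P).
Implicit Types (x y z : X) (f g h : {mset X}).

Definition d1 x y : R := Num.min (mdist x y) (setdist A x + setdist A y).

(* The free commutative monoid D(X) is [{mset X}]; [inDA f] says that [f] lies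
   in the submonoid D(A). *)
Definition inDA f : Prop := forall x, x \in f -> A x.

Definition diagram_rel : rel {mset X} :=
  fun f g => `[< exists a b, [/\ inDA a, inDA b & f `+` a = g `+` b] >].

Lemma diagram_relP f g :
  reflect (forall x, ~ A x -> f x = g x) (diagram_rel f g).
Proof.
apply: (iffP (asboolP _)) => [[a [b [Aa Ab /msetP fg]]] x Ax|fg].
  have := fg x; rewrite !msetE2.
  have /mset_eq0P-> : x \notin a by apply/negP => /Aa.
  have /mset_eq0P-> : x \notin b by apply/negP => /Ab.
  by rewrite !addn0.
pose res f := seq_mset [seq x <- f | `[< A x >]].
have resE e x : res e x = (if `[< A x >] then e x else 0)%N.
  rewrite /res mset_seqE count_filter.
  case: ifPn => Ax; last first.
    rewrite (@eq_count _ _ pred0) ?count_pred0// => y /=.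
    by case: eqP => // ->; exact/negbTE.
  rewrite -count_mem_mset; apply: eq_count => y /=.
  by case: eqP => //= ->.
exists (res g), (res f); split.
- by move=> x; rewrite in_mset resE; case: asboolP.
- by move=> x; rewrite in_mset resE; case: asboolP.
- apply/msetP => x; rewrite !msetE2 !resE; case: asboolP => Ax.
    by rewrite addnC.
  by rewrite !addn0 fg.
Qed.

Lemma diagram_rel_refl : reflexive diagram_rel.
Proof. by move=> f; apply/diagram_relP. Qed.

Lemma diagram_rel_sym : symmetric diagram_rel.
Proof.
by move=> f g; apply/diagram_relP/diagram_relP => fg x Ax; rewrite fg.
Qed.

Lemma diagram_rel_trans : transitive diagram_rel.
Proof.
move=> g f h /diagram_relP fg /diagram_relP gh; apply/diagram_relP => x Ax.
by rewrite fg// gh.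
Qed.

Canonical diagram_equiv :=
  EquivRel diagram_rel diagram_rel_refl diagram_rel_sym diagram_rel_trans.

(* D(X, A) = D(X) / D(A) *)
Definition diagram : Type := {eq_quot diagram_rel}.
HB.instance Definition _ := EqQuotient.on diagram.
HB.instance Definition _ := Choice.on diagram.

Definition dclass f : diagram := \pi_diagram f.

Lemma dclassP f g : dclass f = dclass g <-> forall x, ~ A x -> f x = g x.
Proof. by split => [/eqmodP/diagram_relP//|h]; apply/eqmodP/diagram_relP. Qed.

Lemma diagram_ind (Q : diagram -> Prop) :
  (forall f, Q (dclass f)) -> forall a, Q a.
Proof. by move=> h; elim/quotW => f; exact: h. Qed.

Definition diagram_add (a b : diagram) : diagram := dclass (repr a `+` repr b).

Lemma diagram_addE f g : diagram_add (dclass f) (dclass g) = dclass (f `+` g).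
Proof.
have /dclassP fE : dclass (repr (dclass f)) = dclass f by rewrite /dclass reprK.
have /dclassP gE : dclass (repr (dclass g)) = dclass g by rewrite /dclass reprK.
by apply/dclassP => x Ax; rewrite !msetE2 fE// gE.
Qed.

Lemma diagram_addA : associative diagram_add.
Proof.
elim/diagram_ind => f; elim/diagram_ind => g; elim/diagram_ind => h.
by rewrite !diagram_addE; apply/dclassP => x _; rewrite !msetE2 addnA.
Qed.

Lemma diagram_addC : commutative diagram_add.
Proof.
elim/diagram_ind => f; elim/diagram_ind => g.
by rewrite !diagram_addE; apply/dclassP => x _; rewrite !msetE2 addnC.
Qed.

Lemma diagram_add0 : left_id (dclass mset0) diagram_add.
Proof.
elim/diagram_ind => f.
by rewrite diagram_addE; apply/dclassP => x _; rewrite !msetE2 mset0E add0n.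
Qed.

HB.instance Definition _ :=
  GRing.isNmodule.Build diagram diagram_addA diagram_addC diagram_add0.

Lemma dclassD f g : dclass f + dclass g = dclass (f `+` g).
Proof. exact: diagram_addE. Qed.

Definition marginal1 (s : {mset X * X}) : {mset X} := seq_mset (map fst s).
Definition marginal2 (s : {mset X * X}) : {mset X} := seq_mset (map snd s).

Definition matching (a b : diagram) : set {mset X * X} :=
  [set s | dclass (marginal1 s) = a /\ dclass (marginal2 s) = b].

Definition cost (s : seq (X * X)) : R := \sum_(p <- s) d1 p.1 p.2.

Definition W1 (a b : diagram) : R :=
  inf [set cost s | s in matching a b].

(* K(X, A), whose elements are the formal differences [gdiff a b]. *)
Definition vpd : Type := groth diagram.
HB.instance Definition _ := GRing.Zmodule.on vpd.

(* Computed on chosen representatives; by [rhoE] below, the value on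
   [gdiff a b] and [gdiff c d] is [W1 (a + d) (c + b)] for all representatives. *)
Definition rho (x y : vpd) : R :=
  W1 ((repr x).1 + (repr y).2) ((repr y).1 + (repr x).2).

Lemma setdist_has_lbound x : has_lbound [set mdist x a | a in A].
Proof. by exists 0 => _ [a _ <-]; exact: mdist_ge0. Qed.

Lemma setdist_nonempty x : [set mdist x a | a in A] !=set0.
Proof. by have [a Aa] := mp_sub_nonempty P; exists (mdist x a), a. Qed.

Lemma setdist_ge0 x : 0 <= setdist A x.
Proof.
apply: lb_le_inf; first exact: setdist_nonempty.
by move=> _ [a _ <-]; exact: mdist_ge0.
Qed.

Lemma setdist_le x a : A a -> setdist A x <= mdist x a.
Proof. by move=> Aa; apply: ge_inf; [exact: setdist_has_lbound|exists a]. Qed.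

Lemma setdist_sub a : A a -> setdist A a = 0.
Proof.
move=> Aa; apply/eqP; rewrite eq_le setdist_ge0 andbT.
by rewrite (le_trans (setdist_le a Aa))// mdistxx.
Qed.

Lemma setdist_triangle x y : setdist A x <= mdist x y + setdist A y.
Proof.
rewrite -lerBlDl; apply: lb_le_inf; first exact: setdist_nonempty.
move=> _ [a Aa <-]; rewrite lerBlDl.
exact: le_trans (setdist_le x Aa) (metric_triangle _ _ _).
Qed.

Lemma d1_ge0 x y : 0 <= d1 x y.
Proof. by rewrite le_min mdist_ge0 addr_ge0 ?setdist_ge0. Qed.

Lemma d1xx x : d1 x x = 0.
Proof. by rewrite /d1 mdistxx min_l// addr_ge0 ?setdist_ge0. Qed.

Lemma d1_sym x y : d1 x y = d1 y x.
Proof. by rewrite /d1 metric_sym addrC. Qed.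

Lemma d1_sub x a : A a -> d1 x a = setdist A x.
Proof. by move=> Aa; rewrite /d1 (setdist_sub Aa) addr0 min_r// setdist_le. Qed.

Lemma d1_eq0 x y : d1 x y = 0 -> x = y \/ A x /\ A y.
Proof.
rewrite /d1 minEle; case: ifP => _ => [/mdist_positivity|xy]; first by left.
move/eqP: xy; rewrite paddr_eq0 ?setdist_ge0// => /andP[/eqP x0 /eqP y0].
right; split; apply: contrapT => /(@mp_sub_separated _ P); rewrite ?x0 ?y0 ltxx//.
Qed.

Lemma d1_triangle y x z : d1 x z <= d1 x y + d1 y z.
Proof.
have := setdist_triangle x y; have := setdist_triangle z y.
have := setdist_ge0 y; have := metric_triangle x y z.
rewrite (metric_sym z y) /d1 !minEle.
do 3 case: ifP => [|/negbT]; rewrite -?ltNge; lra.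
Qed.

(* Sequences of pairs as matchings, with the marginals given as counting
   functions; only the values outside [A] matter. *)
Definition smatch (s : seq (X * X)) (u v : X -> nat) :=
  forall x, ~ A x -> count_mem x (map fst s) = u x
                  /\ count_mem x (map snd s) = v x.

Lemma cost_ge0 s : 0 <= cost s.
Proof. by apply: sumr_ge0 => p _; exact: d1_ge0. Qed.

Lemma cost_cat s t : cost (s ++ t) = cost s + cost t.
Proof. exact: big_cat. Qed.

Lemma cost_cons p s : cost (p :: s) = d1 p.1 p.2 + cost s.
Proof. exact: big_cons. Qed.

Lemma cost_perm s t : perm_eq s t -> cost s = cost t.
Proof. by move=> st; apply: perm_big. Qed.

Definition diag (s : seq X) := [seq (x, x) | x <- s].

Lemma map_fst_diag s : map fst (diag s) = s.
Proof. by rewrite -map_comp map_id. Qed.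

Lemma map_snd_diag s : map snd (diag s) = s.
Proof. by rewrite -map_comp map_id. Qed.

Lemma cost_diag s : cost (diag s) = 0.
Proof. by rewrite /cost big_map big1// => x _; rewrite d1xx. Qed.

Lemma matchingP (s : {mset X * X}) f g :
  matching (dclass f) (dclass g) s <-> smatch s f g.
Proof.
split=> [[/dclassP s1 /dclassP s2] x Ax|sfg].
  by rewrite -s1// -s2// !mset_seqE.
by split; apply/dclassP => x /sfg[]; rewrite mset_seqE.
Qed.

Lemma matching_seq (s : seq (X * X)) f g : smatch s f g ->
  matching (dclass f) (dclass g) (seq_mset s).
Proof.
move=> sfg; apply/matchingP => x Ax.
have /permP es1 := perm_map fst (perm_eq_seq_mset s).
have /permP es2 := perm_map snd (perm_eq_seq_mset s).
by rewrite es1 es2; exact: sfg.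
Qed.

Lemma costs_has_lbound a b : has_lbound [set cost s | s in matching a b].
Proof. by exists 0 => _ [s _ <-]; exact: cost_ge0. Qed.

Lemma smatch_exists f g : exists s, smatch s f g.
Proof.
have [a Aa] := mp_sub_nonempty P.
exists ([seq (x, a) | x <- f] ++ [seq (a, x) | x <- g]) => x Ax.
rewrite !map_cat -!map_comp !count_cat.
have xa (s : seq X) : count_mem x [seq a | _ <- s] = 0%N.
  elim: s => //= _ s ->; rewrite addn0.
  by case: eqP => // ax; rewrite -ax in Ax.
rewrite (@eq_map _ _ (fst \o _) id)// (@eq_map _ _ (snd \o (fun y => (y, a))) (fun=> a))//.
rewrite (@eq_map _ _ (snd \o _) id)// (@eq_map _ _ (fst \o (fun y => (a, y))) (fun=> a))//.
by rewrite !xa !map_id addn0 add0n !count_mem_mset.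
Qed.

Lemma costs_nonempty a b : [set cost s | s in matching a b] !=set0.
Proof.
move: a b; elim/diagram_ind => f; elim/diagram_ind => g.
have [s sfg] := smatch_exists f g.
by exists (cost (seq_mset s)), (seq_mset s) => //; exact: matching_seq.
Qed.

Lemma W1_ge0 a b : 0 <= W1 a b.
Proof.
apply: lb_le_inf; first exact: costs_nonempty.
by move=> _ [s _ <-]; exact: cost_ge0.
Qed.

Lemma W1_le s f g : smatch s f g -> W1 (dclass f) (dclass g) <= cost s.
Proof.
move=> sfg; apply: ge_inf; first exact: costs_has_lbound.
exists (seq_mset s); first exact: matching_seq.
exact/cost_perm/perm_eq_seq_mset.
Qed.

Lemma W1_lt f g e : W1 (dclass f) (dclass g) < e ->
  exists2 s, smatch s f g & cost s < e.
Proof.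
move=> /(inf_lt (costs_nonempty _ _))[_ [s /matchingP sfg <-] se].
by exists s.
Qed.

Lemma W1_le_transfer f g f' g' :
  (forall s, smatch s f g -> exists2 t, smatch t f' g' & cost t <= cost s) ->
  W1 (dclass f') (dclass g') <= W1 (dclass f) (dclass g).
Proof.
move=> h; apply/ler_addgt0Pr => e e0.
have [|s sfg se] := @W1_lt f g (W1 (dclass f) (dclass g) + e).
  by rewrite ltrDl.
have [t tfg ts] := h s sfg.
exact: le_trans (W1_le tfg) (le_trans ts (ltW se)).
Qed.

Lemma W1xx a : W1 a a = 0.
Proof.
elim/diagram_ind: a => f; apply/eqP; rewrite eq_le W1_ge0 andbT.
rewrite -(cost_diag f); apply: W1_le => x _.
by rewrite map_fst_diag map_snd_diag count_mem_mset.
Qed.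

Lemma W1_sym_le a b : W1 a b <= W1 b a.
Proof.
move: a b; elim/diagram_ind => f; elim/diagram_ind => g.
apply: W1_le_transfer => s sfg; exists [seq (p.2, p.1) | p <- s].
  move=> x /sfg[s1 s2]; rewrite -!map_comp -s1 -s2.
  by split; congr (count_mem x _); apply: eq_map.
by rewrite /cost big_map; apply: ler_sum => p _; rewrite d1_sym.
Qed.

Lemma W1_sym a b : W1 a b = W1 b a.
Proof. by apply/eqP; rewrite eq_le !W1_sym_le. Qed.

Lemma glue_eq s t : map snd s = map fst t ->
  exists u, [/\ map fst u = map fst s, map snd u = map snd t &
                cost u <= cost s + cost t].
Proof.
elim: s t => [|[x y] s IHs] [|[y' z] t] //=.
  by move=> _; exists [::]; rewrite /cost !big_nil addr0.
move=> [<-] /IHs[u [u1 u2 ust]]; exists ((x, z) :: u).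
rewrite /= u1 u2 !cost_cons /=; split => //.
by have := d1_triangle y x z; lra.
Qed.

Lemma perm_map_lift (l : seq X) (t : seq (X * X)) : perm_eq l (map fst t) ->
  exists2 t', perm_eq t' t & map fst t' = l.
Proof.
have [a _] := mp_sub_nonempty P.
move=> /(perm_iotaP a)[Is pIs ->].
exists [seq nth (a, a) t i | i <- Is].
  rewrite size_map in pIs.
  rewrite -{2}(mkseq_nth (a, a) t) /mkseq; exact: perm_map.
rewrite -map_comp; apply/eq_in_map => i; rewrite (perm_mem pIs) mem_iota /=.
by rewrite add0n size_map => it; rewrite (nth_map (a, a)).
Qed.

Lemma glue s t (u v w : X -> nat) : smatch s u v -> smatch t v w ->
  exists2 r, smatch r u w & cost r <= cost s + cost t.
Proof.
move=> suv tvw.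
pose FA (l : seq X) := [seq x <- l | `[< A x >]].
have FAE x l : count_mem x (FA l) = (if `[< A x >] then count_mem x l else 0)%N.
  rewrite count_filter; case: ifPn => Ax.
    by apply: eq_count => y /=; case: eqP => //= ->.
  rewrite (@eq_count _ _ pred0) ?count_pred0// => y /=.
  by case: eqP => // ->; exact/negbTE.
pose s' := s ++ diag (FA (map fst t)).
pose t' := t ++ diag (FA (map snd s)).
have st : perm_eq (map snd s') (map fst t').
  apply/allP => x _ /=; apply/eqP.
  rewrite !map_cat !count_cat map_fst_diag map_snd_diag !FAE.
  case: asboolP => Ax; first by rewrite addnC.
  by rewrite (suv _ Ax).2 (tvw _ Ax).1.
have [t'' pt tE] := perm_map_lift st.
have [r [r1 r2 rst]] := glue_eq (esym tE).
exists r.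
  move=> x Ax; have [Ex _] := suv x Ax; have [_ Wx] := tvw x Ax.
  rewrite r1 r2; have /permP-> := perm_map snd pt.
  rewrite !map_cat !count_cat map_fst_diag map_snd_diag !FAE.
  by rewrite asboolF// !addn0.
by rewrite (cost_perm pt) !cost_cat !cost_diag !addr0 in rst.
Qed.

Lemma W1_triangle b a c : W1 a c <= W1 a b + W1 b c.
Proof.
move: b a c; elim/diagram_ind => g; elim/diagram_ind => f; elim/diagram_ind => h.
apply/ler_addgt0Pr => e e0.
have [|s sfg se] := @W1_lt f g (W1 (dclass f) (dclass g) + e / 2).
  by rewrite ltrDl divr_gt0.
have [|t tgh te] := @W1_lt g h (W1 (dclass g) (dclass h) + e / 2).
  by rewrite ltrDl divr_gt0.
have [r rfh rst] := glue sfg tgh.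
by have := W1_le rfh; lra.
Qed.

Lemma remove_point s x : x \in map fst s -> x \in map snd s ->
  exists u, [/\ perm_eq (x :: map fst u) (map fst s),
                perm_eq (x :: map snd u) (map snd s) & cost u <= cost s].
Proof.
move=> /mapP[[x' y] + /= xE] xs; rewrite -{x'}xE => xys.
have ps := perm_to_rem xys; set s1 := rem _ s in ps.
have ps2 := perm_map snd ps.
have ps1 := perm_map fst ps.
rewrite (cost_perm ps) cost_cons /=.
have [yx|yx] := eqVneq y x.
  exists s1; rewrite perm_sym ps1 yx d1xx add0r; split => //.
  by rewrite yx in ps2; rewrite perm_sym.
have : x \in map snd s1.
  by move: xs; rewrite (perm_mem ps2) inE /= eq_sym (negbTE yx).
move=> /mapP[[z x'] + /= xx']; rewrite -{x'}xx' => zxs.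
have pr := perm_to_rem zxs; set s2 := rem _ s1 in pr.
exists ((z, y) :: s2); split.
- rewrite perm_sym (perm_trans ps1)//= perm_cons.
  exact: perm_map pr.
- rewrite perm_sym (perm_trans ps2)//=.
  apply: (@perm_trans _ [:: y, x & map snd s2]).
    by rewrite perm_cons; exact: perm_map pr.
  by apply/permP => q /=; rewrite addnCA.
- rewrite (cost_perm pr) !cost_cons /=.
  by have := d1_triangle x z y; lra.
Qed.

Lemma cancel_points (k : seq X) s (u v : X -> nat) :
  smatch s (fun x => u x + count_mem x k)%N (fun x => v x + count_mem x k)%N ->
  exists2 t, smatch t u v & cost t <= cost s.
Proof.
elim: k s => [|x k IHk] s suv.
  by exists s => // x /suv[]; rewrite /= !addn0.
have [Ax|Ax] := pselect (A x).
  apply: IHk => y Ay; have [/= -> ->] := suv y Ay.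
  by case: eqP => // xy; rewrite xy in Ax.
have [/= s1 s2] := suv x Ax; rewrite eqxx in s1 s2.
have [||t [t1 t2 ts]] := @remove_point s x.
- by rewrite -has_pred1 has_count s1 addnA addnAC addn1.
- by rewrite -has_pred1 has_count s2 addnA addnAC addn1.
have [|r ruv rt] := IHk t.
  move=> y /suv[].
  move/permP: t1 => <-; move/permP: t2 => <- /=.
  rewrite !(addnCA _ (x == y)) => /addnI e1 /addnI e2.
  by rewrite e1 e2.
by exists r => //; exact: le_trans ts.
Qed.

Lemma W1_add2r c a b : W1 (a + c) (b + c) = W1 a b.
Proof.
move: c a b; elim/diagram_ind => h; elim/diagram_ind => f; elim/diagram_ind => g.
rewrite !dclassD; apply/eqP; rewrite eq_le; apply/andP; split.
  apply: W1_le_transfer => s sfg; exists (s ++ diag h).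
    move=> x /sfg[s1 s2]; rewrite !map_cat !count_cat s1 s2.
    by rewrite map_fst_diag map_snd_diag !msetE2 !count_mem_mset.
  by rewrite cost_cat cost_diag addr0.
apply: W1_le_transfer => s sfg; apply: (@cancel_points h) => x /sfg.
by rewrite !msetE2 !count_mem_mset.
Qed.

Lemma finite_gap (l : seq R) : exists2 c : R, 0 < c &
  forall r, r \in l -> 0 <= r -> r < c -> r = 0.
Proof.
elim: l => [|r l [c c0 IH]]; first by exists 1.
have [r0|r0] := ltP 0 r.
  exists (Num.min c r); first by rewrite lt_min c0.
  move=> q; rewrite inE lt_min => /predU1P[->|ql] q0 /andP[qc qr].
    by rewrite ltxx in qr.
  exact: IH.
exists c => // q; rewrite inE => /predU1P[->|ql] q0 qc; last exact: IH.
by apply/eqP; rewrite eq_le r0.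
Qed.

Lemma W1_eq0 a b : W1 a b = 0 -> a = b.
Proof.
move: a b; elim/diagram_ind => f; elim/diagram_ind => g fg0.
have [a Aa] := mp_sub_nonempty P.
pose L := a :: (enum_mset f ++ enum_mset g).
have [c c0 cP] := finite_gap [seq d1 x y | x <- L, y <- L].
have [|s sfg sc] := @W1_lt f g c; first by rewrite fg0.
pose n x := if `[< A x >] then a else x.
have nd x y : d1 (n x) (n y) = d1 x y.
  rewrite /n; case: asboolP => Ax; case: asboolP => Ay => //.
  - by rewrite d1xx d1_sub// setdist_sub.
  - by rewrite d1_sym [RHS]d1_sym !d1_sub.
  - by rewrite !d1_sub.
have nL p : p \in s -> n p.1 \in L /\ n p.2 \in L.
  move=> ps; rewrite /n; split; case: asboolP => Ax; rewrite ?mem_head//.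
    rewrite in_cons mem_cat -!has_pred1 [X in _ || (X || _)]has_count.
    rewrite count_mem_mset -(sfg _ Ax).1 -has_count !has_pred1.
    by rewrite (map_f fst ps) orbT.
  rewrite in_cons mem_cat -!has_pred1 [X in _ || (_ || X)]has_count.
  rewrite count_mem_mset -(sfg _ Ax).2 -has_count !has_pred1.
  by rewrite (map_f snd ps) !orbT.
have s0 p : p \in s -> p.1 = p.2 \/ A p.1 /\ A p.2.
  move=> ps; apply: d1_eq0; rewrite -nd; apply: cP.
  - by apply: allpairs_f; have [] := nL p ps.
  - exact: d1_ge0.
  - rewrite nd; apply: le_lt_trans sc.
    rewrite (cost_perm (perm_to_rem ps)) cost_cons lerDl.
    exact: cost_ge0.
apply/dclassP => x Ax; have [<- <-] := sfg x Ax.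
rewrite !count_map; apply: eq_in_count => p /s0 /= [->//|[A1 A2]].
by apply/eqP/eqP => px; rewrite px in A1 A2.
Qed.

Implicit Types u v w : vpd.

Lemma rhoE (a b c d : diagram) :
  rho (gdiff a b : vpd) (gdiff c d : vpd) = W1 (a + d) (c + b).
Proof.
rewrite /rho; have := gdiff_repr (gdiff a b : vpd).
case: (repr _) => a' b' /= /gdiffP[k abk].
have := gdiff_repr (gdiff c d : vpd).
case: (repr _) => c' d' /= /gdiffP[l cdl].
rewrite -(W1_add2r (b + k + (d + l))).
rewrite -[RHS](W1_add2r (b' + k + (d' + l))).
congr W1.
  rewrite !addrA [LHS](ACl ((1*3*4)*(2*5*6)))/= abk.
  by rewrite !addrA [RHS](ACl (1*3*4*5*2*6))/=.
rewrite !addrA [LHS](ACl ((1*5*6)*(2*3*4)))/= cdl.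
by rewrite !addrA [RHS](ACl (1*5*6*3*2*4))/=.
Qed.

Lemma rhoxx u : rho u u = 0.
Proof. by elim/groth_ind: u => a b; rewrite rhoE W1xx. Qed.

Lemma rho_eq0 u v : rho u v = 0 -> u = v.
Proof.
elim/groth_ind: u => a b; elim/groth_ind: v => c d.
by rewrite rhoE => /W1_eq0 abcd; apply/gdiffP; exists 0; rewrite abcd.
Qed.

Lemma rho_sym u v : rho u v = rho v u.
Proof.
elim/groth_ind: u => a b; elim/groth_ind: v => c d.
by rewrite !rhoE W1_sym.
Qed.

Lemma rho_triangle v u w : rho u w <= rho u v + rho v w.
Proof.
elim/groth_ind: u => a b; elim/groth_ind: v => c d; elim/groth_ind: w => e f.
rewrite !rhoE -(W1_add2r d) -(W1_add2r f (a + d)) -(W1_add2r b (c + f)).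
rewrite (addrAC a) (addrAC c f) (addrAC e b).
exact: W1_triangle.
Qed.

Lemma rho_add2r w u v : rho (u + w) (v + w) = rho u v.
Proof.
elim/groth_ind: u => a b; elim/groth_ind: v => c d; elim/groth_ind: w => e f.
rewrite [_ + _](gdiffD a) [gdiff c d + _](gdiffD c).
rewrite !rhoE -[RHS](W1_add2r (e + f)).
by rewrite addrACA (addrACA c e).
Qed.

(* The topology of [vpd] used from here on is the one this instance generates. *)
HB.instance Definition _ :=
  isMetric.Build R vpd rhoxx rho_eq0 rho_sym rho_triangle.

Lemma mdist_vpdE u v : mdist u v = rho u v :> R.
Proof. by []. Qed.

Lemma rho_sub u v u' v' : rho (u - v) (u' - v') <= rho u u' + rho v v'.
Proof.
apply: le_trans (rho_triangle (u' - v) _ _) _; rewrite rho_add2r lerD2l.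
rewrite -(rho_add2r (v + v' - u')) rho_sym.
have -> : u' - v' + (v + v' - u') = v.
  by rewrite addrC addrA subrK addrK.
suff -> : u' - v + (v + v' - u') = v' by [].
by rewrite addrC addrA subrK addrAC subrr add0r.
Qed.

Import metricType_numDomainType.

Lemma vpd_sub_continuous : continuous (fun p : vpd * vpd => p.1 - p.2).
Proof.
move=> [u v]; apply/cvgrPdist_lt => e e0 /=.
have e20 : 0 < e / 2 by rewrite divr_gt0.
near=> p; rewrite mdist_vpdE; apply: le_lt_trans (rho_sub _ _ _ _) _.
rewrite [ltRHS]splitr ltrD//; near: p.
  exact: (cvgr_dist_lt (@cvg_fst _ _ _ _ _)).
exact: (cvgr_dist_lt (@cvg_snd _ _ _ _ _)).
Unshelve. all: by end_near. Qed.

HB.instance Definition _ :=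
  PreTopologicalNmodule_isTopologicalZmodule.Build vpd vpd_sub_continuous.

End MetricPairDiagrams.

Arguments vpd {R} P.

Definition discrete_space (T : topologicalType) : Prop :=
  forall U : set T, open U.

(* Main.v *)
Require Import Defs.
From mathcomp Require Import all_boot all_order all_algebra.
From mathcomp Require Import finmap multiset.
From mathcomp Require Import all_classical all_reals all_analysis.
From mathcomp Require Import lra.

(** If [K(X, A)] is not discrete, then [d1] takes arbitrarily small positive
    values, since two diagrams at distance less than every positive value of
    [d1] are at distance zero ([d1_gap_discrete]).  Fix [r > 0].  Given such a
    small value [e = d1 x y], choose [n] with [n * e] between [r / 2] and [r],
    and let [w] be [n] times the difference [x - y].  Moving the [n] copies of
    [x] to [y] shows that [w] lies within [r] of [0].

    Such elements cannot accumulate at any [u].  The function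
    [z |-> min (e, d1 z y)], normalised to vanish on [A], is 1-Lipschitz for
    [d1], so by the easy half of Kantorovich duality ([W1_ge_psum]) the
    difference of its integrals over [w] and [u] bounds [rho u w] from below.
    Its integral over [w] is [n * e >= r / 2], whereas over [u] it is at most
    [e] times the number of points of [u], because the function is bounded by
    [e] ([rho_dipole_ge]).  Thus, along a sequence of values [e] tending to
    [0], the elements [w] eventually leave the ball of radius [r / 4] around
    any given [u]; no ball around [0] is then contained in a compact set. *)

Set Implicit Arguments.
Unset Strict Implicit.
Unset Printing Implicit Defensive.

Import Order.TTheory GRing.Theory Num.Theory.

Local Open Scope classical_set_scope.
Local Open Scope ring_scope.

Section VirtualDiagrams.
Context {R : realType} {P : metricPair R}.
Local Notation X := (mp_space P).
Local Notation A := (@mp_sub R P).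
Implicit Types (x y z : X) (l f g : seq X) (phi : X -> R) (u v w : vpd P).

Definition psum phi l : R := \sum_(z <- l) phi z.

Definition sdiag l : diagram P := dclass (seq_mset l).

Definition vdiff f g : vpd P := gdiff (sdiag f) (sdiag g).

Lemma sdiagD f g : sdiag f + sdiag g = sdiag (f ++ g).
Proof.
rewrite /sdiag dclassD; congr (dclass _); apply/msetP => x.
by rewrite !msetE2 !mset_seqE count_cat.
Qed.

Lemma vdiff_ind (Q : vpd P -> Prop) : (forall f g, Q (vdiff f g)) -> forall u, Q u.
Proof.
move=> h; elim/groth_ind; elim/(@diagram_ind R P) => f; elim/(@diagram_ind R P) => g.
by rewrite -(seq_mset_id f) -(seq_mset_id g); exact: h.
Qed.

Lemma rho_vdiff f g f' g' :
  rho (vdiff f g) (vdiff f' g') = W1 (sdiag (f ++ g')) (sdiag (f' ++ g)).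
Proof. by rewrite rhoE !sdiagD. Qed.

Lemma psum_eq_off phi l l' : (forall z, A z -> phi z = 0) ->
  (forall z, ~ A z -> count_mem z l = count_mem z l') -> psum phi l = psum phi l'.
Proof.
move=> phiA ll'; rewrite /psum.
have E k : \sum_(z <- k) phi z = \sum_(z <- [seq z <- k | ~~ `[< A z >]]) phi z.
  rewrite big_filter [RHS]big_mkcond; apply: eq_bigr => z _.
  by case: asboolP => //= /phiA.
rewrite E [RHS]E; apply/perm_big/allP => z _ /=.
have C k : count_mem z [seq t <- k | ~~ `[< A t >]] =
    if `[< A z >] then 0%N else count_mem z k.
  rewrite count_filter; case: asboolP => Az.
    rewrite -(count_pred0 k); apply: eq_count => t /=.
    by case: eqP => //= ->; rewrite asboolT.
  by apply: eq_count => t /=; case: eqP => //= ->; rewrite asboolF.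
by rewrite !C; case: asboolP => // /ll' ->.
Qed.

(** The easy half of Kantorovich duality: sum the Lipschitz bound over the
    pairs of a matching.  The marginals of a matching are prescribed only off
    [A], hence the condition that [phi] vanish on [A]. *)
Lemma W1_ge_psum phi f g : (forall z, A z -> phi z = 0) ->
  (forall x y, phi x - phi y <= d1 x y) ->
  psum phi f - psum phi g <= W1 (sdiag f) (sdiag g).
Proof.
move=> phiA lip; apply/ler_addgt0Pr => e e0.
have [|s sfg /ltW se] := @W1_lt _ _ (seq_mset f) (seq_mset g) (W1 (sdiag f) (sdiag g) + e).
  by rewrite ltrDl.
apply: le_trans se.
rewrite (@psum_eq_off phi f (map fst s))//; last first.
  by move=> z /sfg[-> _]; rewrite mset_seqE.
rewrite (@psum_eq_off phi g (map snd s))//; last first.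
  by move=> z /sfg[_ ->]; rewrite mset_seqE.
by rewrite /psum /cost !big_map -sumrB; apply: ler_sum => p _; exact: lip.
Qed.

(** The bump [z |-> min (d1 x y, d1 z y)], shifted by its constant value
    on [A]. *)
Lemma bump_exists x y : exists phi,
  [/\ forall z, A z -> phi z = 0,
      forall z t, phi z - phi t <= d1 z t,
      phi x - phi y = d1 x y & forall z, `|phi z| <= d1 x y].
Proof.
have [a Aa] := mp_sub_nonempty P.
pose h z := Num.min (d1 x y) (d1 z y).
have h0 z : 0 <= h z by rewrite le_min !d1_ge0.
have h1 z : h z <= d1 x y by rewrite ge_min lexx.
exists (fun z => h z - h a); split => [z Az|z t||z].
- by rewrite /h (d1_sym z) (d1_sym a) (d1_sub _ Az) (d1_sub _ Aa) subrr.
- suff : h z - h t <= d1 z t by lra.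
  have := d1_triangle t z y; have := d1_ge0 z t.
  by rewrite /h !minEle; do 2 case: ifP => [|/negbT]; rewrite -?ltNge; lra.
- by rewrite /h d1xx minxx (min_r (d1_ge0 _ _)); lra.
- by rewrite ler_norml; have := h0 z; have := h1 z; have := h0 a; have := h1 a; lra.
Qed.

Lemma psum_norm_le phi e l : (forall z, `|phi z| <= e) ->
  `|psum phi l| <= e *+ size l.
Proof.
move=> phie; apply: le_trans (ler_norm_sum _ _ _) _.
rewrite -iter_addr_0 -count_predT -big_const_seq; exact: ler_sum.
Qed.

Definition dipole n x y : vpd P := vdiff (nseq n x) (nseq n y).

Lemma rho_dipole_le n x y : rho 0 (dipole n x y) <= d1 x y *+ n.
Proof.
have nil0 : sdiag [::] = 0.
  by apply/dclassP => z _; rewrite mset_seqE mset0E.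
rewrite (_ : 0 = vdiff [::] [::]); last by rewrite /vdiff nil0.
rewrite rho_vdiff cats0 /= W1_sym.
have -> : d1 x y *+ n = cost (nseq n (x, y)).
  by rewrite /cost big_nseq iter_addr_0.
by apply: W1_le => z _; rewrite !map_nseq !mset_seqE.
Qed.

(** A bump of height [d1 x y] separates [x] from [y] at full rate, but sees
    each point of [u] with weight at most [d1 x y]. *)
Lemma rho_dipole_ge u : exists k : nat, forall n x y,
  d1 x y *+ n - d1 x y *+ k <= rho u (dipole n x y).
Proof.
elim/vdiff_ind: u => f g; exists (size f + size g)%N => n x y.
have [phi [phiA lip phixy phie]] := bump_exists x y.
rewrite rho_sym rho_vdiff; apply: le_trans (W1_ge_psum _ _ phiA lip).
have := psum_norm_le f phie; have := psum_norm_le g phie.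
rewrite /psum !big_cat !big_nseq !iter_addr_0 /= -phixy mulrnDr mulrnBl.
rewrite !ler_norml; lra.
Qed.

(** If no value of [d1] lies strictly between [0] and [e], a matching of cost
    less than [e] has cost [0]. *)
Lemma d1_gap_discrete (e : R) : 0 < e ->
  (forall x y, d1 x y < e -> d1 x y = 0) -> discrete_space (vpd P).
Proof.
move=> e0 gap U; rewrite openE => u Uu.
suff ue : ball u e `<=` U by apply: filterS ue _; exact: nbhsx_ballx.
rewrite ballEmdist => v /=; rewrite mdist_vpdE => uv.
suff -> : v = u by [].
apply/esym/rho_eq0; move: uv {Uu}.
elim/groth_ind: u => a b; elim/groth_ind: v => c d; rewrite rhoE.
move: (a + d) (c + b); elim/(@diagram_ind R P) => f; elim/(@diagram_ind R P) => g.
move=> /W1_lt[s sfg se]; apply/eqP; rewrite eq_le W1_ge0 andbT.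
suff <- : cost s = 0 by exact: W1_le.
rewrite /cost big_seq big1 // => p ps; apply: gap; apply: le_lt_trans se.
by rewrite (cost_perm (perm_to_rem ps)) cost_cons lerDl cost_ge0.
Qed.

Lemma multiple_between (e r : R) : 0 < e -> e < r / 2 ->
  exists n : nat, r / 2 <= e *+ n < r.
Proof.
move=> e0 er; exists (Num.truncn (r / 2 / e)).+1.
have /truncn_itv/andP[] : 0 <= r / 2 / e by rewrite divr_ge0 ?ltW//; lra.
rewrite ler_pdivlMr// ltr_pdivrMr// => n1 n2.
rewrite -[e *+ _]mulr_natl; apply/andP; split; first exact: ltW.
by rewrite -natr1; lra.
Qed.

End VirtualDiagrams.

Theorem theorem3p2 (R : realType) (P : metricPair R) :
  locally_compact [set: vpd P] <-> discrete_space (vpd P).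
Proof.
split=> [lc|disc]; last first.
  move=> u _; rewrite withinET; exists [set u].
    by apply/open_nbhs_nbhs; split.
  split; first exact: compact_set1.
  by rewrite -openC; exact: disc.
have := lc 0 I; rewrite withinET => -[U /nbhs_ballP[r /= r0 rU] [cU _]].
apply: contrapT => ndisc.
have small (e : R) : 0 < e -> exists x y : P, 0 < d1 x y < e.
  move=> e0; apply: contrapT => gap; apply: ndisc.
  apply: (d1_gap_discrete e0) => x y xye.
  apply/eqP; rewrite eq_le d1_ge0 andbT leNgt; apply/negP => xy0.
  by apply: gap; exists x, y; rewrite xy0.
have dipoles (m : nat) : exists w : vpd P, rho 0 w < r /\
    exists n x y, [/\ w = dipole n x y, r / 2 <= d1 x y *+ n &
                      d1 x y * m.+1%:R < r / 4].
  (* Any fixed [k <= m] then satisfies [k * d1 x y < r / 4]. *)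
  have [|x [y /andP[xy0 xye]]] := small (r / 4 / m.+1%:R).
    by rewrite !divr_gt0.
  rewrite ltr_pdivlMr// in xye.
  have [||n /andP[n1 n2]] := @multiple_between _ (d1 x y) r => //.
    have : d1 x y <= d1 x y * m.+1%:R by rewrite ler_peMr ?ler1n// ltW.
    by lra.
  exists (dipole n x y); split; first exact: le_lt_trans (rho_dipole_le _ _ _) n2.
  by exists n, x, y.
have {dipoles} [w wP] := choice dipoles.
have [|u [_ clu]] := cU (w @ \oo) _.
  by exists 0%N => // m _; apply: rU; rewrite ballEmdist; exact: (wP m).1.
(* From index [k] on, the distance from [w m] to [u] exceeds
   [r / 2 - r / 4]. *)
have [k kP] := rho_dipole_ge u.
have ur : nbhs u (ball u (r / 4)) by apply: nbhsx_ballx; rewrite divr_gt0.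
have wk : (w @ \oo) [set w m | m in [set m | (k <= m)%N]].
  by exists k => // m /= km; exists m.
have [_ [[m /= km <-]]] := clu _ _ wk ur.
rewrite ballEmdist /= mdist_vpdE.
have [_ [n [x [y [-> n1 n2]]]]] := wP m.
have := kP n x y.
have : d1 x y *+ k <= d1 x y * m.+1%:R.
  by rewrite -[_ *+ k]mulr_natr ler_wpM2l ?d1_ge0// ler_nat leqW.
lra.
Qed.
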